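(* Given a finite field $\mathbf{F}_q$ and integers $n \ge 2$, $d \ge 1$, there exists a smooth projective geometrically integral hypersurface $X$ in $\mathbf{P}^n$ over $\mathbf{F}_q$ such that for each $f \in S_1 \cup \dots \cup S_d$, $H_f \cap X$ fails to be smooth of dimension $n-2$.
   Context: $S = \mathbf{F}_q[x_0,\dots,x_n]$, $S_e$ its homogeneous polynomials of degree $e$; $H_f = \operatorname{Proj}(S/(f)) \subseteq \mathbf{P}^n$; $\cap$ is scheme-theoretic intersection. *)

(* Defs.v *)
From HB Require Import structures.
From mathcomp Require Import all_boot all_order all_algebra all_field.
From mathcomp Require Import mpoly.
Set Implicit Arguments. Unset Strict Implicit. Unset Printing Implicit Defensive.
Import Order.TTheory GRing.Theory Num.Theory.
Local Open Scope ring_scope.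

(* p is homogeneous of (total) degree e, i.e. p \in S_e (0 is in every S_e). *)
Definition is_homog {K : nzRingType} {m : nat} (e : nat) (p : {mpoly K[m]}) : bool :=
  p \is @ishomog1 m K e mdeg.

Definition mirreducible {L : fieldType} {m : nat} (p : {mpoly L[m]}) : Prop :=
  (1 < msize p)%N /\
  forall g h : {mpoly L[m]}, p = g * h -> (msize g <= 1)%N \/ (msize h <= 1)%N.

Definition geom_irreducible {K : fieldType} {m : nat} (p : {mpoly K[m]}) : Prop :=
  forall (L : closedFieldType) (iota : {rmorphism K -> L}),
    mirreducible (map_mpoly iota p).

(* For homogeneous g_0,...,g_{r-1} in K[x_0..x_n], the closed subscheme
   Proj(S/(g_0,...,g_{r-1})) of P^n_K is smooth of dimension n - r.
   Stated via the Jacobian criterion at every geometric point: for every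
   algebraically closed extension L of K and every point P of P^n(L) on
   which all g_k vanish, the r x (n+1) Jacobian matrix (d g_k / d x_j)(P)
   has rank r. *)
Definition proj_smooth_codim {K : fieldType} (n r : nat)
    (g : 'I_r -> {mpoly K[n.+1]}) : Prop :=
  forall (L : closedFieldType) (iota : {rmorphism K -> L}) (P : 'I_n.+1 -> L),
    (exists i, P i != 0) ->
    (forall k, (map_mpoly iota (g k)).@[P] = 0) ->
    \rank (\matrix_(k < r, j < n.+1) ((map_mpoly iota (g k))^`M(j)).@[P]) = r.

Definition hyp_smooth {K : fieldType} (n : nat) (F : {mpoly K[n.+1]}) : Prop :=
  proj_smooth_codim (fun _ : 'I_1 => F).

Definition inter_smooth {K : fieldType} (n : nat) (f F : {mpoly K[n.+1]}) : Prop :=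
  proj_smooth_codim (fun k : 'I_2 => if k == ord0 then f else F).

(* Main.v *)
Require Import Defs.
From HB Require Import structures.
From mathcomp Require Import all_boot all_order all_algebra all_field.
From mathcomp Require Import mpoly ring zify.
Set Implicit Arguments. Unset Strict Implicit. Unset Printing Implicit Defensive.
Import GRing.Theory.
Local Open Scope ring_scope.

(** If [s] is a power of the characteristic, then [F = sum_i x_i G_i ^ s] has
    gradient [(G_i ^ s)_i], so that it is smooth as soon as the forms [G_i] have
    no common zero. At a point over the field of order [s] the gradient of [F]
    is the value of [G], and the theorem becomes an interpolation problem: on
    the hypersurface of every form [f] of degree at most [d] one selects a point
    [P] with [P_0 = 1], no two of them conjugate, and [G P] has to be
    proportional to the gradient of [f] at [P].
    Let [gam_i = x_i ^ m + (multiple of x_0)] take the prescribed values for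
    [i > 0]. These forms have no common zero on [x_0 = 0]. Since
    [P . G P = 0] determines [G_0 P], one may take [G_i = gam_i] up to
    Frobenius powers for [i > 0] and, up to powers of [x_0],
    [G_0 = prod_j (1 - gam_j ^ (s - 1)) - sum_j x_j gam_j], which is nonzero
    where all [gam_j] vanish. The hyperplane [x_0 = 0] itself is made tangent at
    [(0 : 1 : 0 ..)] by multiplying [G_1] with a power of [x_0] and adding to
    [G_0] the difference of two powers of [gam_1] that agree at all [P]. *)

(** * Partial derivatives and evaluation of forms *)

Lemma mderivXn n (R : comNzRingType) i k (f : {mpoly R[n]}) :
  (f ^+ k)^`M(i) = f ^+ k.-1 * f^`M(i) *+ k.
Proof.
elim: k => [|[|k] IH]; first by rewrite mulr0n expr0 -mpolyC1 mderivC.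
  by rewrite expr1 mul1r.
by rewrite exprS mderivM IH /= mulrnAr mulrA -exprS [RHS]mulrS [f^`M(i) * _]mulrC.
Qed.

Lemma expr0_gt0 (R : pzSemiRingType) k : (0 < k)%N -> 0 ^+ k = 0 :> R.
Proof. by case: k => // k _; rewrite exprS mul0r. Qed.

Lemma expr_pow (R : pzSemiRingType) (x : R) s r : x ^+ s = x -> x ^+ (s ^ r) = x.
Proof. by move=> xs; elim: r => [|r IH]; rewrite ?expr1 // expnSr exprM IH. Qed.

Section Evaluation.
Context (n : nat) (K : fieldType).

Lemma is_homogP k (f : {mpoly K[n]}) :
  reflect (forall m, m \in msupp f -> mdeg m = k) (is_homog k f).
Proof. exact: dhomogP. Qed.

Lemma rmorph_mmap (S T : comNzRingType) (iota : {rmorphism K -> S})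
    (phi : {rmorphism S -> T}) (P : 'I_n -> S) (f : {mpoly K[n]}) :
  phi (mmap iota P f) = mmap (phi \o iota) (phi \o P) f.
Proof.
rewrite /mmap rmorph_sum; apply: eq_bigr => m _.
rewrite rmorphM rmorph_prod; congr (_ * _).
by apply: eq_bigr => i _; rewrite rmorphXn.
Qed.

Lemma eq_mmap (S : comNzRingType) (g h : K -> S) (P Q : 'I_n -> S) f :
  g =1 h -> P =1 Q -> mmap g P f = mmap h Q f.
Proof.
move=> egh ePQ; apply: eq_bigr => m _; rewrite egh; congr (_ * _).
exact: mmap1_eq.
Qed.

Lemma meval_map_mpoly (L : fieldType) (iota : {rmorphism K -> L})
    (P : 'I_n -> L) (f : {mpoly K[n]}) :
  (map_mpoly iota f).@[P] = mmap iota P f.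
Proof.
rewrite /map_mpoly (rmorph_mmap (@mpolyC n L \o iota) (meval P)).
by apply: eq_mmap => i /=; rewrite ?mevalC ?mevalXU.
Qed.

Lemma mderiv_map_mpoly (L : fieldType) (iota : {rmorphism K -> L}) i
    (f : {mpoly K[n]}) :
  (map_mpoly iota f)^`M(i) = map_mpoly iota f^`M(i).
Proof.
by apply/mpolyP => m; rewrite mcoeff_mderiv !mcoeff_map_mpoly mcoeff_mderiv raddfMn.
Qed.

Lemma mmap_homog_scale (S : comNzRingType) (iota : {rmorphism K -> S})
    (P : 'I_n -> S) c k (f : {mpoly K[n]}) :
  is_homog k f -> mmap iota (fun i => c * P i) f = c ^+ k * mmap iota P f.
Proof.
move=> /is_homogP hf; rewrite /mmap mulr_sumr; apply: eq_big_seq => m /hf <-.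
rewrite mulrCA; congr (_ * _); rewrite mdegE expr_sum -big_split /=.
by apply: eq_bigr => i _; rewrite exprMn.
Qed.

Lemma euler_homog k (f : {mpoly K[n]}) :
  is_homog k f -> \sum_i 'X_i * f^`M(i) = f *+ k.
Proof.
move=> /is_homogP hf; rewrite [f in RHS]mpolyE -sumrMnl.
transitivity (\sum_(m <- msupp f) \sum_i f@_m *: ('X_[m] *+ m i)).
  rewrite exchange_big; apply: eq_bigr => i _ /=.
  rewrite {1}[f]mpolyE raddf_sum mulr_sumr; apply: eq_bigr => m _ /=.
  rewrite mderivZ mderivX -scalerAr -scalerAr -mpolyXD scaler_nat; congr (_ *: _).
  have [->|mi] := posnP (m i); first by rewrite !mulr0n.
  congr ('X_[_] *+ _); apply/mnmP => j; rewrite !mnmE.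
  by case: (i =P j) => [<-|_] /=; rewrite ?mnm1E ?eqxx ?subn1 ?add1n ?prednK ?subn0 ?add0n.
apply: eq_big_seq => m /hf <-.
by rewrite -scaler_sumr sumrMnr -mdegE scalerMnr.
Qed.

End Evaluation.

(** * Frobenius powers over a finite field *)

Section FiniteField.
Context (K : finFieldType).

Lemma card_pchar_nat (S : nzRingType) (iota : {rmorphism K -> S}) r :
  (GRing.pchar S).-nat (#|K| ^ r)%N.
Proof.
have [p p_pr pK] := finPcharP K.
rewrite (card_pprimeChar pK) !pnatX pnatE // (fmorph_pchar iota).
by rewrite [p \in _]pK.
Qed.

Lemma natr_card0 (S : nzRingType) (iota : {rmorphism K -> S}) r :
  (0 < r)%N -> (#|K| ^ r)%:R = 0 :> S.
Proof.
move=> r_gt0; have [p p_pr pK] := finPcharP K.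
have pS : p \in GRing.pchar S by rewrite (fmorph_pchar iota).
apply/eqP; rewrite -(dvdn_pcharf pS) Euclid_dvdX // r_gt0 andbT.
have [k k0 ->] : exists2 k, (0 < k)%N & #|K| = (p ^ k)%N.
  exists (logn p #|pPrimeCharType pK|); last exact: card_pprimeChar.
  rewrite lt0n; apply: contraTneq (finNzRing_gt1 K) => k0.
  by rewrite (card_pprimeChar pK) k0.
exact: dvdn_exp.
Qed.

Lemma card_exp_gt1 r : (0 < r)%N -> (1 < #|K| ^ r)%N.
Proof. by move=> r_gt0; rewrite -(exp1n r) ltn_exp2r // finNzRing_gt1. Qed.

Lemma expr_cardX (x : K) r : x ^+ (#|K| ^ r) = x.
Proof. by elim: r => [|r IH]; rewrite ?expr1 // expnSr exprM IH expf_card. Qed.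

Lemma mmap_frobenius n (S : comNzRingType) (iota : {rmorphism K -> S})
    (P : 'I_n -> S) r f :
  (forall i, P i ^+ (#|K| ^ r) = P i) ->
  mmap iota P f ^+ (#|K| ^ r) = mmap iota P f.
Proof.
move=> hP; rewrite /mmap; elim: (msupp f) => [|m l IH].
  by rewrite big_nil expr0n expn_eq0 eqn0Ngt ltnW ?finNzRing_gt1.
rewrite big_cons exprDn_pchar ?(card_pchar_nat iota) // IH exprMn -rmorphXn expr_cardX.
rewrite /mmap1 -prodrXl; congr (_ * _ + _).
by apply: eq_bigr => i _; rewrite exprAC hP.
Qed.

(** With [q] the order of [K], the residues of ['X ^+ (q ^ i)] modulo a monic polynomial that kills
    [z] lie in a finite set, so two of them agree. Hence [z ^+ (q ^ i) = z ^+ (q ^ j)] for some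
    [i < j], and Frobenius, being injective, can be cancelled [i] times. *)
Lemma integral_frobenius_fixed (L : fieldType) (iota : {rmorphism K -> L}) z :
  integralOver iota z -> exists2 j, (0 < j)%N & z ^+ (#|K| ^ j) = z.
Proof.
move=> [p p_mon pz]; pose d := (size p).-1; pose T := 'rV[K]_d.
have pn0 := monic_neq0 p_mon.
pose g (i : 'I_#|T|.+1) : T := poly_rV (modp ('X ^+ (#|K| ^ i)) p).
have /injectivePn [i [j ij gij]] : ~~ injectiveb g.
  by apply/negP => /injectiveP /leq_card; rewrite card_ord ltnn.
wlog ltij : i j ij gij / (i < j)%N.
  move=> W; case: (ltngtP i j) => [|ji|eij]; first exact: W ij gij.
    by apply: W ji; rewrite // eq_sym.
  by rewrite (val_inj eij) eqxx in ij.
have szm k : (size (modp ('X ^+ k) p) <= d)%N.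
  by rewrite -ltnS prednK ?ltn_modp // size_poly_gt0.
have {}gij : modp ('X ^+ (#|K| ^ i)) p = modp ('X ^+ (#|K| ^ j)) p.
  by rewrite -[LHS](poly_rV_K (szm _)) -[RHS](poly_rV_K (szm _)) -/(g i) gij.
have ev k : z ^+ k = (map_poly iota (modp 'X^k p)).[z].
  have {1}-> : z ^+ k = (map_poly iota 'X^k).[z] by rewrite map_polyXn hornerXn.
  by rewrite {1}(divp_eq 'X^k p) rmorphD rmorphM hornerD hornerM (rootP pz) mulr0 add0r.
exists (j - i)%N; first by rewrite subn_gt0.
have : (z ^+ (#|K| ^ (j - i)) - z) ^+ (#|K| ^ i) = 0.
  rewrite exprDn_pchar ?(card_pchar_nat iota) // exprNn_pchar ?(card_pchar_nat iota) //.
  by rewrite -exprM -expnD subnK ?(ltnW ltij) // !ev gij subrr.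
by move/eqP; rewrite expf_eq0 => /andP[_]; rewrite subr_eq0 => /eqP.
Qed.

End FiniteField.

(** * Points of forms over an algebraically closed field *)

Lemma digits_inj n N (a b : 'I_n -> nat) :
  (forall i, (a i < N)%N) -> (forall i, (b i < N)%N) ->
  (\sum_i a i * N ^ i = \sum_i b i * N ^ i)%N -> a =1 b.
Proof.
elim: n a b => [|n IH] a b ha hb; first by move=> _ [].
rewrite !big_ord_recl !muln1.
have shift (c : 'I_n.+1 -> nat) : (\sum_(i < n) c (lift ord0 i) * N ^ bump 0 i =
    (\sum_(i < n) c (lift ord0 i) * N ^ i) * N)%N.
  by rewrite big_distrl; apply: eq_bigr => i _; rewrite /= expnSr mulnA.
rewrite !shift => e.
have N_gt0 : (0 < N)%N := leq_ltn_trans (leq0n _) (ha ord0).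
have e0 : a ord0 = b ord0.
  by move/(congr1 (modn^~ N)): e; rewrite ![(_ ord0 + _)%N]addnC !modnMDl !modn_small.
move: e; rewrite e0 => /addnI /eqP; rewrite eqn_pmul2r // => /eqP e.
have hS := IH _ _ (fun i => ha (lift ord0 i)) (fun i => hb (lift ord0 i)) e.
by move=> i; case: (unliftP ord0 i) => [j|] ->.
Qed.

Section Points.
Context (K : fieldType) (L : closedFieldType) (iota : {rmorphism K -> L}).

(* Kronecker substitution [x_i := tau ^ N ^ i] for [i > 0]. *)
Lemma nonvanishing_on_hyperplane n (f : {mpoly K[n.+1]}) m0 :
  m0 \in msupp f -> m0 ord0 = 0%N ->
  exists B : 'I_n.+1 -> L, B ord0 = 0 /\ mmap iota B f != 0.
Proof.
move=> m0f m00; pose N := msize f.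
pose code (m : 'X_{1..n.+1}) := (\sum_(i < n.+1) m i * N ^ i)%N.
have small m i : m \in msupp f -> (m i < N)%N.
  by move/msize_mdeg_lt; apply: leq_ltn_trans; rewrite mdegE (bigD1 i) //= leq_addr.
pose s0 := [seq m : 'X_{1..n.+1} <- msupp f | m ord0 == 0%N].
have m0s : m0 \in s0 by rewrite mem_filter m00 m0f.
(* This is [f] with 0 put for [x_0] and the substitution made in the rest. The exponents of [f] are
   less than [N], so distinct monomials get distinct codes and the coefficient of [m0] survives. *)
pose Phi := \sum_(m <- s0) (iota f@_m)%:P * 'X^(code m).
have coefPhi : Phi`_(code m0) = iota f@_m0.
  rewrite coef_sum (bigD1_seq m0) ?filter_uniq ?msupp_uniq //= coefCM coefXn eqxx mulr1.
  rewrite big_seq_cond big1 ?addr0 // => m /andP[]; rewrite mem_filter => /andP[_ mf].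
  rewrite coefCM coefXn => /eqP ne; case: eqP => [/digits_inj e|_]; last by rewrite mulr0.
  by case: ne; apply/mnmP => i; rewrite e // => j; apply: small.
have /closed_nonrootP [tau] : Phi != 0.
  apply: contraTneq m0f => Phi0; move: coefPhi; rewrite Phi0 coef0 => /esym/eqP.
  by rewrite fmorph_eq0 mcoeff_msupp negbK.
move=> nroot; exists (fun i => if i == ord0 then 0 else tau ^+ (N ^ i)); split=> //.
apply: contraNneq nroot => v0; apply/rootP; rewrite -[RHS]v0 horner_sum /mmap.
rewrite big_filter big_mkcond /=; apply: eq_bigr => m _.
rewrite /mmap1 /code !big_ord_recl eqxx expr0n; case: eqP => [->|_]; last by rewrite mul0r mulr0.
rewrite mul0n add0n mul1r hornerCM hornerXn expr_sum; congr (_ * _).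
by apply: eq_bigr => i _; rewrite -exprM mulnC.
Qed.

(** A nonconstant restriction of [f] to the line has a root. If the restriction were a constant [c],
    homogeneity would give [f (B + u A) = c u ^ k] for all [u], and [u = 0] would contradict
    [f B != 0]. *)
Lemma line_meets n (f : {mpoly K[n]}) k (A B : 'I_n -> L) :
  is_homog k f -> (0 < k)%N -> mmap iota B f != 0 ->
  exists t, mmap iota (fun i => A i + t * B i) f = 0.
Proof.
move=> hf k_gt0 fB.
pose th (A B : 'I_n -> L) := mmap (polyC \o iota) (fun i => (A i)%:P + (B i) *: 'X) f.
have thE C D t : (th C D).[t] = mmap iota (fun i => C i + t * D i) f.
  rewrite -[LHS]/(horner_eval t _) (rmorph_mmap _ (horner_eval t)).
  by apply: eq_mmap => i /=; rewrite /horner_eval !hornerE // mulrC.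
have [sz|] := eqVneq (size (th A B)) 1%N; last first.
  by move/closed_rootP => [t /rootP]; rewrite thE; exists t.
have [c thc] : exists c, th A B = c%:P by exists (th A B)`_0; apply: size1_polyC; rewrite sz.
case/eqP: fB; rewrite -[LHS](_ : (th B A).[0] = _); last first.
  by rewrite thE; apply: eq_mmap => i //=; rewrite mul0r addr0.
suff -> : th B A = c *: 'X^k by rewrite !hornerE expr0n eqn0Ngt k_gt0 mulr0.
(* The extra factor ['X] forces the nonroot [u] to be nonzero, so that one can scale by [u]. *)
apply/eqP; rewrite -subr_eq0; apply/eqP/(mulIf (negbT (polyX_eq0 L))); rewrite mul0r.
apply/eqP/negbNE/negP => /closed_nonrootP [u]; rewrite /root hornerM hornerX mulf_eq0 negb_or.
case/andP => + u0; rewrite !hornerE subr_eq0 thE => /eqP; case.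
transitivity (u ^+ k * (th A B).[u^-1]); last by rewrite thc hornerC mulrC.
rewrite thE -mmap_homog_scale //; apply: eq_mmap => i //=.
by rewrite mulrDr mulVKf // addrC.
Qed.

End Points.

(** * Points of a form outside a given finite field *)

Lemma mpolyX_factor n (K : fieldType) (i : 'I_n) (f : {mpoly K[n]}) :
  (forall m, m \in msupp f -> (0 < m i)%N) ->
  exists2 g : {mpoly K[n]}, f = 'X_i * g &
    forall m, (m \in msupp g) = ((U_(i) + m)%MM \in msupp f).
Proof.
move=> hf; exists (\sum_(m <- msupp f) f@_m *: 'X_[m - U_(i)]).
  rewrite {1}[f]mpolyE mulr_sumr; apply: eq_big_seq => m /hf mi.
  rewrite -scalerAr -mpolyXD addmC submK //.
  by apply/mnm_lepP => j; rewrite mnm1E; case: eqP => // <-.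
set g := \sum_(m <- _) _; suff -> : f = g * 'X_i.
  by move=> m; rewrite !mcoeff_msupp mcoeffMX.
rewrite {1}[f]mpolyE mulr_suml; apply: eq_big_seq => m /hf mi.
rewrite -scalerAl -mpolyXD submK //.
by apply/mnm_lepP => j; rewrite mnm1E; case: eqP => // <-.
Qed.

Section PointsOff.
Context (K : finFieldType) (L : closedFieldType) (iota : {rmorphism K -> L}).
Context (r : nat) (r_gt0 : (0 < r)%N).
Local Notation s := (#|K| ^ r)%N.

Let s_gt1 : (1 < s)%N.
Proof. exact: card_exp_gt1. Qed.

Let frobD (x y : L) : (x + y) ^+ s = x ^+ s + y ^+ s.
Proof. by rewrite exprDn_pchar // (card_pchar_nat iota). Qed.

Lemma exists_not_fixed : exists z : L, z ^+ s != z.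
Proof.
have /closed_nonrootP [z] : 'X^s - 'X != 0 :> {poly L}.
  by rewrite -size_poly_gt0 size_polyDl ?size_polyXn // size_polyN size_polyX ltnS.
by rewrite /root !hornerE subr_eq0; exists z.
Qed.

(* Among the affine lines with a given direction at infinity, some line has no
   point that is fixed by Frobenius: for [B_1 = b B_2], the points of the line
   through [(c, 0, ..)] satisfy [y_1 = c + b y_2], and [c ^ s - c] is chosen
   outside of [(b - b ^ s) * E], where [E] is the fixed field. *)
Lemma exists_line_off n (B : 'I_n.+3 -> L) :
  B ord0 = 0 ->
  exists2 A : 'I_n.+3 -> L, A ord0 = 1 &
    forall t, exists l, (A l + t * B l) ^+ s != A l + t * B l.
Proof.
move=> B0; pose i1 : 'I_n.+3 := inord 1; pose i2 : 'I_n.+3 := inord 2.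
have v1 : i1 = 1%N :> nat by rewrite inordK.
have v2 : i2 = 2 :> nat by rewrite inordK.
have [z z_nfix] := exists_not_fixed.
have [B2|B2] := eqVneq (B i2) 0.
  (* Coordinate 2 is then constant along the line, so it can be set to the unfixed [z]. *)
  exists (fun i : 'I_n.+3 => if i == 0%N :> nat then 1 else z) => // t.
  by exists i2; rewrite v2 B2 mulr0 addr0.
pose b := B i1 / B i2; pose beta := b - b ^+ s.
have [c c_nfix c_off] : exists2 c, (beta = 0 -> c ^+ s != c) &
    (beta != 0 -> c ^+ s - c = beta * z).
  have [->|beta0] := eqVneq beta 0; first by exists z.
  have /closed_rootP [c] : size ('X^s - 'X - (beta * z)%:P) != 1%N.
    rewrite -addrA size_polyDl ?size_polyXn; first by rewrite eqSS -lt0n ltnW.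
    rewrite (leq_ltn_trans (size_polyD _ _)) // !size_polyN size_polyX gtn_max ltnS s_gt1.
    by rewrite (leq_ltn_trans (size_polyC_leq1 _)) // ltnS ltnW.
  rewrite /root !hornerE subr_eq0 => /eqP hc; exists c => // e.
  by rewrite e eqxx in beta0.
exists (fun i : 'I_n.+3 => if i == 0%N :> nat then 1 else if i == 1%N :> nat then c else 0) => // t.
pose e := t * B i2; have te : t * B i1 = b * e.
  by rewrite /b /e mulrCA divfK // mulrC.
have [e_fix|] := eqVneq (e ^+ s) e; last by exists i2; rewrite v2 add0r.
exists i1; rewrite v1 /= te frobD exprMn e_fix; apply/eqP => fix1.
have {fix1} g : c ^+ s - c = beta * e.
  by rewrite -(addrK (b ^+ s * e) (c ^+ s)) fix1 /beta; ring.
have [beta0|beta0] := eqVneq beta 0.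
  by move: (c_nfix beta0); rewrite -subr_eq0 g beta0 mul0r eqxx.
move: g; rewrite c_off // => /(mulfI beta0) ez.
by rewrite ez e_fix eqxx in z_nfix.
Qed.

(** Factors [x_0] are divided out until some monomial is free of [x_0]; one exists at the latest
    before degree 0, since [f] is no multiple of [x_0 ^ k]. Then [f] is nonzero at some [B] with
    [x_0 = 0], and a line with direction [B] without fixed points meets the zeros of [f]. *)
Lemma exists_point_off n (f : {mpoly K[n.+3]}) k :
  is_homog k f -> (exists2 m, m \in msupp f & m ord0 != k) ->
  exists P : 'I_n.+3 -> L,
    [/\ P ord0 = 1, mmap iota P f = 0 & exists l, P l ^+ s != P l].
Proof.
elim: k f => [|k IH] f hf [m mf mk].
  by move/is_homogP/(_ m mf)/eqP: hf mk; rewrite mdeg_eq0 => /eqP ->; rewrite mnm0E eqxx.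
have [/hasP [m0 m0f /eqP m00]|/hasPn pos] := boolP (has (fun m : 'X_{1..n.+3} => m ord0 == 0%N) (msupp f)).
  have [B [B0 fB]] := nonvanishing_on_hyperplane iota m0f m00.
  have [A A0 offA] := exists_line_off B0.
  have [t ft] := line_meets A hf isT fB.
  by exists (fun i => A i + t * B i); split=> //; rewrite A0 B0 mulr0 addr0.
have [g fg gsupp] := @mpolyX_factor _ _ ord0 f (fun m mf => etrans (lt0n _) (pos m mf)).
have m_pos : (0 < m ord0)%N by rewrite lt0n pos.
have mE : (U_(ord0) + (m - U_(ord0)))%MM = m.
  by rewrite addmC submK //; apply/mnm_lepP => j; rewrite mnm1E; case: eqP => // <-.
have [||P [P0 gP offP]] := IH g.
- apply/is_homogP => m'; rewrite gsupp => /(is_homogP _ _ hf).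
  by rewrite mdegD mdeg1 add1n => -[].
- exists (m - U_(ord0))%MM; first by rewrite gsupp mE.
  by rewrite mnmBE mnm1E eqxx subn1 -eqSS prednK.
by exists P; split=> //; rewrite fg rmorphM /= gP mulr0.
Qed.

End PointsOff.

(** * Closure properties of homogeneous forms *)

Section Homogeneous.
Context (n : nat) (K : fieldType).
Implicit Types (f g : {mpoly K[n]}).

Lemma is_homogM d e k f g :
  (d + e)%N = k -> is_homog d f -> is_homog e g -> is_homog k (f * g).
Proof. by move=> <-; apply: dhomogM. Qed.

Lemma is_homogXn d e k f : (d * e)%N = k -> is_homog d f -> is_homog k (f ^+ e).
Proof. by move=> <-; apply: dhomogMn. Qed.

Lemma is_homogD k f g : is_homog k f -> is_homog k g -> is_homog k (f + g).
Proof. exact: dhomogD. Qed.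

Lemma is_homogB k f g : is_homog k f -> is_homog k g -> is_homog k (f - g).
Proof. by move=> hf hg; apply: dhomogD => //; rewrite dhomogN. Qed.

Lemma is_homog0 k : is_homog k (0 : {mpoly K[n]}).
Proof. exact: dhomog0. Qed.

Lemma is_homog_sum (I : Type) (l : seq I) (P : pred I) k (F : I -> {mpoly K[n]}) :
  (forall i, P i -> is_homog k (F i)) -> is_homog k (\sum_(i <- l | P i) F i).
Proof.
move=> h; elim/big_rec: _ => [|i f Pi hf]; first exact: is_homog0.
by apply: is_homogD => //; apply: h.
Qed.

Lemma is_homog_prod_ord l k (f : 'I_l -> {mpoly K[n]}) :
  (forall i, is_homog k (f i)) -> is_homog (l * k) (\prod_i f i).
Proof.
elim: l f => [|l IH] f hf; first by rewrite big_ord0; apply: dhomog1.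
by rewrite big_ord_recl mulSn; apply: is_homogM (hf _) (IH _ _).
Qed.

Lemma is_homogX i : is_homog 1 ('X_i : {mpoly K[n]}).
Proof. by rewrite /is_homog dhomogX /= mdeg1. Qed.

Lemma is_homogXX i e : is_homog e ('X_i ^+ e : {mpoly K[n]}).
Proof. exact: is_homogXn (mul1n e) (is_homogX i). Qed.

Lemma is_homog_mderiv k i f : is_homog k f -> is_homog k.-1 f^`M(i).
Proof.
move/is_homogP => hf; apply/is_homogP => m; rewrite mcoeff_msupp mcoeff_mderiv.
have [mf _|] := boolP ((m + U_(i))%MM \in msupp f).
  by rewrite -(hf _ mf) mdegD mdeg1 addn1.
by rewrite mcoeff_msupp negbK => /eqP ->; rewrite mul0rn eqxx.
Qed.

End Homogeneous.

(** * Selection of the points and interpolation of the gradients *)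

Section Selection.
Context (K : finFieldType) (L : closedFieldType) (iota : {rmorphism K -> L}).
Hypothesis L_alg : integralRange iota.

Lemma common_fixed_field n (P : 'I_n -> L) :
  exists2 j, (0 < j)%N & forall i, P i ^+ (#|K| ^ j) = P i.
Proof.
have /fin_all_exists [j hj] : forall i, exists j, (0 < j)%N && (P i ^+ (#|K| ^ j) == P i).
  move=> i; have [j j_gt0 Pj] := integral_frobenius_fixed (L_alg (P i)).
  by exists j; rewrite j_gt0 Pj eqxx.
exists (\prod_i j i)%N => [|i]; first by apply: prodn_gt0 => i; case/andP: (hj i).
by rewrite (bigD1 i) //= expnM expr_pow //; case/andP: (hj i) => _ /eqP.
Qed.

(** The coordinate [ord0] is left out because Euler's relation recovers it from the others. The
    scalar may be 0, when [P] is singular on [f]; the last clause asks separately for a nonzero [V],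
    which makes the product in [gauss0] vanish at [P]. *)
Definition tangency_data n (s : nat) (V : 'I_n.+3 -> {mpoly K[n.+3]})
    (f : {mpoly K[n.+3]}) (P : 'I_n.+3 -> L) :=
  [/\ P ord0 = 1, forall i, P i ^+ s = P i, mmap iota P f = 0,
      exists c, forall i, i != ord0 -> mmap iota P f^`M(i) = c * mmap iota P (V i) &
      exists2 i, i != ord0 & mmap iota P (V i) != 0].

(* The form [chi] below vanishes at the points already selected, which
   have coordinates in the field of order [s], and is 1 at the new point. *)
Lemma exists_tangency_data n (fs : seq {mpoly K[n.+3]}) :
  (forall f, f \in fs -> exists2 k, is_homog k f & exists2 m, m \in msupp f & m ord0 != k) ->
  exists r D (V : 'I_n.+3 -> {mpoly K[n.+3]}),
    [/\ (0 < r)%N, forall i, is_homog D (V i) &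
        forall f, f \in fs -> exists P, tangency_data (#|K| ^ r) V f P].
Proof.
elim: fs => [|f fs IH] hfs.
  by exists 1%N, 0%N, (fun=> 0); split=> // i; apply: is_homog0.
have [g gfs|r [D [V [r_gt0 hV Vfs]]]] := IH.
  by apply: hfs; rewrite inE gfs orbT.
have [k hf mf] := hfs f (mem_head _ _).
have [P [P0 fP [l Pl]]] := exists_point_off iota r_gt0 hf mf.
have [j j_gt0 Pj] := common_fixed_field P.
(* The field of order [s'] contains both the field of order [s] and the coordinates of [P]. *)
pose s := (#|K| ^ r)%N; pose s' := (#|K| ^ (r * j))%N.
have P_fix i : P i ^+ s' = P i by rewrite /s' mulnC expnM expr_pow.
have s'_gt1 : (1 < s')%N by rewrite card_exp_gt1 // muln_gt0 r_gt0.
pose x0 : {mpoly K[n.+3]} := 'X_ord0.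
(* Where [x_0 = 1], [w] vanishes exactly if coordinate [l] lies in the field of order [s]. At [P] it
   is a nonzero element of the field of order [s'], whose power [s' - 1] is 1. *)
pose w : {mpoly K[n.+3]} := 'X_l ^+ s - 'X_l * x0 ^+ (s - 1).
pose chi := w ^+ (s' - 1); pose delta := (s * (s' - 1))%N.
have evX Q i : mmap iota Q 'X_i = Q i by rewrite mmapX mmap1U.
have evw Q : Q ord0 = 1 -> mmap iota Q w = Q l ^+ s - Q l.
  by move=> Q0; rewrite /w rmorphB rmorphM !rmorphXn /= !evX Q0 expr1n mulr1.
have chi_old Q : Q ord0 = 1 -> Q l ^+ s = Q l -> mmap iota Q chi = 0.
  move=> Q0 Ql; rewrite /chi rmorphXn /= evw // Ql subrr expr0n.
  by rewrite subn_eq0 leqNgt s'_gt1.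
have chi_new : mmap iota P chi = 1.
  have w0 : mmap iota P w != 0 by rewrite evw // subr_eq0.
  apply: (mulfI w0); rewrite /chi rmorphXn /= -exprS subn1 prednK ?(ltnW s'_gt1) //.
  by rewrite mulr1 mmap_frobenius.
have chi_homog : is_homog delta chi.
  apply: is_homogXn (erefl _) _; apply: is_homogB; first exact: is_homogXX.
  apply: is_homogM (is_homogX _ _) (is_homogXX _ _ _).
  by rewrite subnKC // ltnW // card_exp_gt1.
clearbody chi; pose grad0 := [forall i, (i != ord0) ==> (mmap iota P f^`M(i) == 0)].
(* If the relevant derivatives of [f] vanish at [P], they are 0 times any target, and a power of
   [x0] in coordinate 1 keeps the target nonzero. *)
pose T i := if grad0 then (if i == inord 1 then x0 ^+ k.-1 else 0) else f^`M(i).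
have hT i : is_homog k.-1 (T i).
  rewrite /T; case: ifP => _; last exact: is_homog_mderiv.
  by case: ifP => _; [apply: is_homogXX | apply: is_homog0].
have T_grad : exists c, forall i, i != ord0 -> mmap iota P f^`M(i) = c * mmap iota P (T i).
  rewrite /T; have [/forallP g0|_] := boolP grad0; last first.
    by exists 1 => i _; rewrite mul1r.
  by exists 0 => i i0; rewrite mul0r; apply/eqP; apply: (implyP (g0 i)).
have T_neq0 : exists2 i, i != ord0 & mmap iota P (T i) != 0.
  rewrite /T; have [_|/forallPn [i]] := boolP grad0; last first.
    by rewrite negb_imply => /andP[]; exists i.
  exists (inord 1); first by rewrite -val_eqE /= inordK.
  by rewrite eqxx rmorphXn /= evX P0 expr1n oner_neq0.
(* Interpolation between [V] where [chi] is 0 and [T] where [chi] is 1; the powers of [x0] equalize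
   the degrees. *)
pose W i := V i * (x0 ^+ delta - chi) * x0 ^+ k.-1 + chi * T i * x0 ^+ D.
have W_old Q i : Q ord0 = 1 -> Q l ^+ s = Q l -> mmap iota Q (W i) = mmap iota Q (V i).
  move=> Q0 Ql; rewrite /W rmorphD !rmorphM rmorphB !rmorphXn /= evX Q0 chi_old //.
  by rewrite !expr1n !mul0r subr0 !mulr1 addr0.
have W_new i : mmap iota P (W i) = mmap iota P (T i).
  rewrite /W rmorphD !rmorphM rmorphB !rmorphXn /= evX P0 chi_new.
  by rewrite !expr1n subrr mulr0 mul0r add0r mul1r mulr1.
exists (r * j)%N, (D + delta + k.-1)%N, W; split=> [|i|g].
- by rewrite muln_gt0 r_gt0.
- apply: is_homogD.
    apply: is_homogM (erefl _) _ (is_homogXX _ _ _).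
    apply: is_homogM (erefl _) (hV i) _.
    by apply: is_homogB => //; apply: is_homogXX.
  have hD : (delta + k.-1 + D)%N = (D + delta + k.-1)%N by lia.
  by apply: is_homogM hD (is_homogM (erefl _) _ (hT i)) (is_homogXX _ _ _).
rewrite inE => /predU1P[->|/Vfs [Q [Q0 Qs gQ [c hc] [i i0 Vi]]]].
  exists P; split=> //; first by case: T_grad => c hc; exists c => i i0; rewrite W_new hc.
  by case: T_neq0 => i i0 Ti; exists i => //; rewrite W_new.
exists Q; split=> //; first by move=> i'; rewrite expnM expr_pow.
  by exists c => i' i'0; rewrite W_old // hc.
by exists i => //; rewrite W_old.
Qed.

End Selection.

(** * Restriction to lines, and failure of the Jacobian criterion *)

Lemma mmap_map_mpoly n (K L : fieldType) (S : comNzRingType) (iota : {rmorphism K -> L})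
    (g : {rmorphism L -> S}) (P : 'I_n -> S) (f : {mpoly K[n]}) :
  mmap g P (map_mpoly iota f) = mmap (g \o iota) P f.
Proof.
rewrite /map_mpoly (rmorph_mmap (@mpolyC n L \o iota) (mmap g P)).
by apply: eq_mmap => i /=; rewrite ?mmapC ?mmapX ?mmap1U.
Qed.

Lemma msize_homog n (K : fieldType) k (f : {mpoly K[n]}) :
  is_homog k f -> f != 0 -> msize f = k.+1.
Proof. by move=> /is_homogP hf f0; rewrite -mlead_deg // hf // mlead_supp. Qed.

Lemma map_mpoly_homog n (K L : fieldType) (iota : {rmorphism K -> L}) k
    (f : {mpoly K[n]}) :
  is_homog k f -> is_homog k (map_mpoly iota f).
Proof.
move/is_homogP => hf; apply/is_homogP => m; rewrite mcoeff_msupp mcoeff_map_mpoly.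
by rewrite fmorph_eq0 -mcoeff_msupp; apply: hf.
Qed.

Lemma size_mmap_poly n (L : fieldType) (Q : 'I_n -> {poly L}) (f : {mpoly L[n]}) :
  (forall i, (size (Q i) <= 2)%N) -> (size (mmap polyC Q f) <= msize f)%N.
Proof.
move=> hQ; rewrite /mmap big_seq; elim/big_rec: _ => [|m p /msize_mdeg_lt mf sp]; first by rewrite size_poly0.
rewrite (leq_trans (size_polyD _ _)) // geq_max sp andbT mul_polyC.
rewrite (leq_trans (size_scale_leq _ _)) // (leq_trans _ mf) //.
rewrite (leq_trans (size_prod_leq _ _)) // leq_subLR.
rewrite addnS ltnS -sum1_card mdegE -big_split /=.
apply: leq_sum => i _; rewrite (leq_trans (size_poly_exp_leq _ _)) // add1n ltnS -[X in (_ <= X)%N]mul1n leq_mul2r.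
by have := hQ i; case: (size _) => [|[|[|]]] //= _; rewrite orbT.
Qed.

Lemma finite_msize_le n (K : finFieldType) d :
  exists fs : seq {mpoly K[n]}, forall f, (msize f <= d)%N -> f \in fs.
Proof.
exists [seq \sum_(m : 'X_{1..n < d}) g m *: 'X_[m] | g : {ffun 'X_{1..n < d} -> K}].
move=> f fd; apply/imageP; exists [ffun m : 'X_{1..n < d} => f@_m] => //.
by rewrite [LHS](mpolywE fd); apply: eq_bigr => m _; rewrite ffunE.
Qed.

Lemma tangent_not_inter_smooth n (K : fieldType) (M : closedFieldType) (j : {rmorphism K -> M})
    (f F : {mpoly K[n.+1]}) (P : 'I_n.+1 -> M) c :
  (exists i, P i != 0) -> mmap j P f = 0 -> mmap j P F = 0 ->
  (forall i, mmap j P f^`M(i) = c * mmap j P F^`M(i)) -> ~ inter_smooth f F.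
Proof.
move=> P0 fP FP grad smooth.
have fF0 (k : 'I_2) : (map_mpoly j (if k == ord0 then f else F)).@[P] = 0.
  by rewrite meval_map_mpoly; case: ifP.
have := smooth M j P P0 fF0; set A := \matrix_(_, _) _ => rA.
(* The row [(1, - c)] is a nontrivial relation between the two gradients. *)
have /(mulmx_free_eq0 (\row_i if i == ord0 :> 'I_2 then 1 else - c)) : row_free A.
  by rewrite /row_free rA.
have -> : (\row_i (if i == ord0 :> 'I_2 then 1 else - c)) *m A = 0.
  apply/rowP => i; rewrite !mxE big_ord_recl big_ord1 !mxE /= !mderiv_map_mpoly !meval_map_mpoly.
  by rewrite grad mul1r mulNr subrr.
rewrite eqxx => /esym/eqP/rowP/(_ ord0); rewrite !mxE eqxx => /eqP.
by rewrite oner_eq0.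
Qed.

(** Restriction to the line cannot raise degrees and preserves that of the product, so it preserves
    that of each factor. The restriction of [g] is thus a nonconstant divisor of ['X^k], that is, a
    positive power of ['X] up to a scalar. *)
Lemma factor_vanishes n (L : fieldType) k (g h : {mpoly L[n]}) (Q : 'I_n -> {poly L}) :
  (forall i, (size (Q i) <= 2)%N) -> g * h != 0 ->
  msize (g * h) = k.+1 -> mmap polyC Q (g * h) = 'X^k -> (1 < msize g)%N ->
  (mmap polyC Q g).[0] = 0.
Proof.
move=> hQ; rewrite mulf_eq0 negb_or => /andP[g0 h0]; rewrite msizeM // rmorphM /=.
set gq := mmap _ _ g; set hq := mmap _ _ h => sz ghq g1.
have gh0 : gq * hq != 0 by rewrite ghq -size_poly_gt0 size_polyXn.
have [gq0 hq0] : gq != 0 /\ hq != 0 by apply/andP; rewrite -negb_or -mulf_eq0.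
have : size (gq * hq) = k.+1 by rewrite ghq size_polyXn.
rewrite size_mul // => szq.
have szg : size gq = msize g.
  have := size_mmap_poly g hQ; have := size_mmap_poly h hQ; rewrite -/gq -/hq.
  have : (0 < size hq)%N by rewrite size_poly_gt0.
  have : (0 < size gq)%N by rewrite size_poly_gt0.
  by move: szq sz; move: (size gq) (size hq) (msize g) (msize h) => a b c d; clear; lia.
have : gq %| ('X - 0%:P) ^+ k by rewrite subr0 -ghq dvdp_mulIl.
case/dvdp_exp_XsubCP => [[|l] _ eqp_gq].
  by move: g1; rewrite -szg (eqp_size eqp_gq) expr0 size_poly1.
apply/rootP; rewrite (eqp_root eqp_gq) rootE subr0 hornerXn.
by rewrite expr0_gt0.
Qed.

(** * The hypersurface, its smoothness and its geometric irreducibility *)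

Section Hypersurface.
Context (K : finFieldType) (n D s m c N : nat) (V : 'I_n.+3 -> {mpoly K[n.+3]}).

(** As powers of [s], the exponents [m] and [c] act trivially on the field of order [s]. The
    inequalities make the exponents of [x0] in [gam] and [gauss0] positive, so that those terms
    vanish on [x_0 = 0]. *)
Definition admissible_exponents :=
  [/\ exists2 r, (0 < r)%N & s = (#|K| ^ r)%N,
      exists a, m = (s ^ a)%N, exists b, c = (s ^ b)%N, N = (m * c)%N &
      [&& D < m, 1 < m & n.+2 * (m * (s - 1)) < N]%N].

Hypotheses (exponents : admissible_exponents) (V_homog : forall i, is_homog D (V i)).

Let s_gt1 : (1 < s)%N.
Proof. by case: exponents => [[r r_gt0 ->] _ _ _ _]; apply: card_exp_gt1. Qed.

Let c_gt0 : (0 < c)%N.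
Proof. by case: exponents => [_ _ [b ->] _ _]; rewrite expn_gt0 ltnW. Qed.

Let NE : N = (m * c)%N.
Proof. by case: exponents. Qed.

Let m_gtD : (D < m)%N.
Proof. by case: exponents => _ _ _ _ /and3P[]. Qed.

Let m_gt1 : (1 < m)%N.
Proof. by case: exponents => _ _ _ _ /and3P[]. Qed.

Let N_gt : (n.+2 * (m * (s - 1)) < N)%N.
Proof. by case: exponents => _ _ _ _ /and3P[]. Qed.

Let N_gtmS : (m.+1 < N)%N.
Proof.
apply: leq_ltn_trans N_gt; rewrite (leq_trans (_ : _ <= 2 * m)%N) //; first by lia.
by rewrite leq_mul // leq_pmulr // subn_gt0.
Qed.

Let N_gtm : (m < N)%N.
Proof. exact: ltnW. Qed.

Local Notation x0 := ('X_ord0 : {mpoly K[n.+3]}).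
Let i1 : 'I_n.+3 := lift ord0 ord0.

(** At points over the field of order [s] with [x_0 = 1] the outer terms cancel and leave [V i]; on
    [x_0 = 0] only the first term survives. *)
Definition gam i : {mpoly K[n.+3]} :=
  'X_i ^+ m + x0 ^+ (m - D) * V i - x0 ^+ (m - 1) * 'X_i.

(** The product excludes common zeros off [x_0 = 0], the difference in [gam i1] contributes
    [x_1 ^ N] on [x_0 = 0], and the last sum places the selected points on the hypersurface. *)
Definition gauss0 : {mpoly K[n.+3]} :=
  x0 ^+ (N - n.+2 * (m * (s - 1))) *
    \prod_(j < n.+2) (x0 ^+ (m * (s - 1)) - gam (lift ord0 j) ^+ (s - 1))
  + gam i1 ^+ c - x0 ^+ (N - m) * gam i1
  - x0 ^+ (N - m.+1) * \sum_(j < n.+2) 'X_(lift ord0 j) * gam (lift ord0 j).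

(* Up to the Frobenius map [x -> x ^ s], the Gauss map of the hypersurface. *)
Definition gauss (i : 'I_n.+3) : {mpoly K[n.+3]} :=
  if i == ord0 then gauss0
  else if i == i1 then x0 ^+ (N - m) * gam i1 else gam i ^+ c.

Definition hypersurface : {mpoly K[n.+3]} := \sum_i 'X_i * gauss i ^+ s.

Lemma gam_homog i : is_homog m (gam i).
Proof.
apply: is_homogB; last first.
  by apply: is_homogM (is_homogXX _ _ _) (is_homogX _ _); lia.
apply: is_homogD; first exact: is_homogXX.
by apply: is_homogM (is_homogXX _ _ _) (V_homog i); lia.
Qed.

Lemma gauss_homog i : is_homog N (gauss i).
Proof.
rewrite /gauss; case: ifP => _; last first.
  case: ifP => _; last exact: is_homogXn (esym NE) (gam_homog i).
  apply: is_homogM (is_homogXX _ _ _) (gam_homog _); exact: subnK (ltnW N_gtm).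
apply: is_homogB.
  apply: is_homogB; last first.
    apply: is_homogM (is_homogXX _ _ _) (gam_homog _); exact: subnK (ltnW N_gtm).
  apply: is_homogD; last exact: is_homogXn (esym NE) (gam_homog _).
  apply: is_homogM (subnK (ltnW N_gt)) (is_homogXX _ _ _) _.
  apply: is_homog_prod_ord => j; apply: is_homogB; first exact: is_homogXX.
  exact: is_homogXn (erefl _) (gam_homog _).
apply: is_homogM (subnK N_gtm) (is_homogXX _ _ _) _.
apply: is_homog_sum => j _; exact: is_homogM (add1n m) (is_homogX _ _) (gam_homog _).
Qed.

Lemma hypersurface_homog : is_homog (N * s).+1 hypersurface.
Proof.
apply: is_homog_sum => i _; apply: is_homogM (add1n _) (is_homogX _ _) _.
exact: is_homogXn (erefl _) (gauss_homog i).
Qed.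

Lemma hypersurface_mderiv i : hypersurface^`M(i) = gauss i ^+ s.
Proof.
have s0 : s%:R = 0 :> {mpoly K[n.+3]}.
  by case: exponents => [[r r_gt0 ->] _ _ _ _]; rewrite (natr_card0 (@mpolyC n.+3 K)).
rewrite /hypersurface raddf_sum (bigD1 i) //= big1 ?addr0 => [|j ji];
  rewrite mderivM mderivXn -mulr_natr s0 !mulr0 addr0 mderivX.
  have -> : (U_(i) - U_(i))%MM = 0%MM by apply/mnmP => j; rewrite mnmBE subnn mnm0E.
  by rewrite mnm1E eqxx scale1r mpolyX0 mul1r.
by rewrite mnm1E (negbTE ji) scale0r mul0r.
Qed.

Section Evaluation.
Context (S : comNzRingType) (iota : {rmorphism K -> S}) (P : 'I_n.+3 -> S).
Local Notation ev := (mmap iota P).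

Let evX i : ev 'X_i = P i.
Proof. by rewrite mmapX mmap1U. Qed.

Lemma mmap_gam i :
  ev (gam i) = P i ^+ m + P ord0 ^+ (m - D) * ev (V i) - P ord0 ^+ (m - 1) * P i.
Proof. by rewrite /gam rmorphB rmorphD !rmorphM /= !rmorphXn /= !evX. Qed.

Lemma mmap_gauss0 :
  ev gauss0 = P ord0 ^+ (N - n.+2 * (m * (s - 1))) *
    \prod_(j < n.+2) (P ord0 ^+ (m * (s - 1)) - ev (gam (lift ord0 j)) ^+ (s - 1))
  + ev (gam i1) ^+ c - P ord0 ^+ (N - m) * ev (gam i1)
  - P ord0 ^+ (N - m.+1) * \sum_(j < n.+2) P (lift ord0 j) * ev (gam (lift ord0 j)).
Proof.
rewrite /gauss0; move: gam => g; rewrite !rmorphB rmorphD !rmorphM /= !rmorphXn /= !evX rmorph_prod rmorph_sum.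
have -> : \prod_(j < n.+2) ev (x0 ^+ (m * (s - 1)) - g (lift ord0 j) ^+ (s - 1)) =
    \prod_(j < n.+2) (P ord0 ^+ (m * (s - 1)) - ev (g (lift ord0 j)) ^+ (s - 1)).
  by apply: eq_bigr => j _; rewrite rmorphB !rmorphXn /= evX.
by congr (_ - _ * _); apply: eq_bigr => j _; rewrite rmorphM /= evX.
Qed.

Lemma mmap_gauss i : i != ord0 ->
  ev (gauss i) = if i == i1 then P ord0 ^+ (N - m) * ev (gam i1) else ev (gam i) ^+ c.
Proof.
move=> /negbTE i0; rewrite /gauss i0; case: ifP => _; last by rewrite rmorphXn.
by rewrite rmorphM /= rmorphXn /= evX.
Qed.

Lemma mmap_hypersurface : ev hypersurface = \sum_i P i * ev (gauss i) ^+ s.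
Proof.
rewrite /hypersurface rmorph_sum; apply: eq_bigr => i _.
by rewrite rmorphM /= rmorphXn /= evX.
Qed.

Lemma gauss_at_infinity i : P ord0 = 0 ->
  ev (gauss i) = if i == ord0 then P i1 ^+ N else if i == i1 then 0 else P i ^+ N.
Proof.
move=> P0.
have gamE j : ev (gam j) = P j ^+ m.
  rewrite mmap_gam P0 !expr0_gt0 ?subn_gt0 //.
  by rewrite !mul0r addr0 subr0.
case: eqP => [->|/eqP i0].
  rewrite /gauss eqxx mmap_gauss0 P0 !expr0_gt0 ?muln_gt0 ?subn_gt0 ?(ltnW m_gt1) //.
  by rewrite !mul0r !subr0 add0r gamE -exprM -NE.
rewrite mmap_gauss // P0 expr0_gt0 ?subn_gt0 // mul0r.
by case: ifP => // _; rewrite gamE -exprM -NE.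
Qed.

End Evaluation.

(** On [x_0 = 0] the entries are [x_1 ^ N], 0 and the [x_i ^ N] with [i > 1]. Elsewhere all [gam i]
    with [i > 0] vanish, which reduces [gauss0] to a power of [x_0]. *)
Lemma gauss_no_common_zero (L : fieldType) (iota : {rmorphism K -> L}) P :
  (forall i, mmap iota P (gauss i) = 0) -> forall i, P i = 0.
Proof.
move=> gP; have [P0|P0] := eqVneq (P ord0) 0.
  have P_eq0 i : P i ^+ N = 0 -> P i = 0 by move/eqP; rewrite expf_eq0 => /andP[_ /eqP].
  move=> i; have := gP i; rewrite gauss_at_infinity //.
  case: eqP => [->|_] //; case: eqP => [->|_]; last exact: P_eq0.
  by have := gP ord0; rewrite gauss_at_infinity // eqxx => /P_eq0.
have gam0 i : i != ord0 -> mmap iota P (gam i) = 0.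
  move=> i0; apply/eqP; move/eqP: (gP i); rewrite mmap_gauss //.
  case: ifP => [/eqP ->|_]; last by rewrite expf_eq0 => /andP[].
  by rewrite mulf_eq0 expf_eq0 (negbTE P0) andbF.
have := gP ord0; rewrite /gauss eqxx mmap_gauss0 !gam0 //.
rewrite expr0_gt0 // mulr0 subr0 addr0.
rewrite (eq_bigr (fun=> P ord0 ^+ (m * (s - 1)))) => [|j _]; last first.
  by rewrite gam0 // expr0_gt0 ?subn_gt0 // subr0.
rewrite [X in _ - _ * X]big1 => [|j _]; last by rewrite gam0 // mulr0.
rewrite mulr0 subr0 prodr_const => /eqP.
by rewrite mulf_eq0 !expf_eq0 (negbTE P0) !andbF.
Qed.

Lemma hypersurface_smooth : hyp_smooth hypersurface.
Proof.
move=> L iota P [i Pi] _; apply/eqP; rewrite eqn_leq rank_leq_row lt0n mxrank_eq0.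
apply: contraNneq Pi => M0; apply/eqP/(gauss_no_common_zero (iota := iota)) => j.
have /eqP := congr1 (fun A : 'M_(1, n.+3) => A ord0 j) M0.
rewrite !mxE mderiv_map_mpoly meval_map_mpoly hypersurface_mderiv rmorphXn /=.
by rewrite expf_eq0 => /andP[_ /eqP].
Qed.

Let N_gt0 : (0 < N)%N.
Proof. exact: leq_trans N_gtm. Qed.

Let s_gt0 : (0 < s)%N.
Proof. exact: ltnW. Qed.

Definition infinite_point (S : pzSemiRingType) (i : 'I_n.+3) : S := (i == i1)%:R.

Lemma gradient_at_infinite_point (S : comNzRingType) (iota : {rmorphism K -> S}) i :
  mmap iota (infinite_point S) hypersurface^`M(i) = (i == ord0)%:R.
Proof.
rewrite hypersurface_mderiv rmorphXn /= gauss_at_infinity // /infinite_point eqxx.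
case: ifP => _; first by rewrite !expr1n.
by case: ifP => [_|ne]; rewrite ?[i == i1]ne !expr0_gt0.
Qed.

Lemma hypersurface_infinite_point (S : comNzRingType) (iota : {rmorphism K -> S}) :
  mmap iota (infinite_point S) hypersurface = 0.
Proof.
rewrite mmap_hypersurface big1 // => i _; rewrite gauss_at_infinity // /infinite_point.
case: eqP => [->|_]; last by rewrite mul0r.
by rewrite (_ : (i1 == ord0) = false) // expr0_gt0 // mulr0.
Qed.

(* On the line [(0 : 1 : z : 0 ..)] the equation is [z ^ e] with [e] its degree,
   so that both factors would vanish at [z = 0], which would be a singular point. *)
Lemma hypersurface_geom_irreducible : geom_irreducible hypersurface.
Proof.
move=> L iota; pose F := map_mpoly iota hypersurface.
pose pt := infinite_point L; pose i2 : 'I_n.+3 := lift ord0 (lift ord0 ord0).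
have gradF : (F^`M(ord0)).@[pt] = 1.
  by rewrite mderiv_map_mpoly meval_map_mpoly gradient_at_infinite_point.
have F0 : F != 0.
  by apply/eqP => F0; move/eqP: gradF; rewrite F0 mderiv0 meval0 eq_sym oner_eq0.
have szF : msize F = (N * s).+2 := msize_homog (map_mpoly_homog iota hypersurface_homog) F0.
split=> [|g h Fgh]; first by rewrite -/F szF.
have [|g1] := leqP (msize g) 1; first by left.
have [|h1] := leqP (msize h) 1; first by right.
pose Q (i : 'I_n.+3) : {poly L} := if i == i1 then 1 else if i == i2 then 'X else 0.
have sizeQ i : (size (Q i) <= 2)%N.
  by rewrite /Q; case: ifP => _; last case: ifP => _; rewrite ?size_poly1 ?size_polyX ?size_poly0.
have FQ : mmap polyC Q F = 'X^((N * s).+1).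
  rewrite /F mmap_map_mpoly mmap_hypersurface (bigD1 i2) //= big1 ?addr0 => [|i i2'].
    by rewrite gauss_at_infinity // /Q /= -exprM exprS.
  rewrite gauss_at_infinity // /Q (negbTE i2'); case: eqP => [->|_]; last by rewrite mul0r.
  by rewrite expr0_gt0 // mulr0.
have eval_pt f : f.@[pt] = (mmap polyC Q f).[0].
  rewrite -[RHS]/(horner_eval 0 _) (rmorph_mmap _ (horner_eval 0)).
  apply: eq_mmap => i /=; rewrite /horner_eval ?hornerC // /Q /pt /infinite_point.
  by case: ifP => _; last case: ifP => _; rewrite hornerE.
have g_pt : g.@[pt] = 0.
  by rewrite eval_pt; apply: (factor_vanishes (h := h) sizeQ _ _ _ g1);
    rewrite -Fgh; [exact: F0 | exact: szF | exact: FQ].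
have h_pt : h.@[pt] = 0.
  by rewrite eval_pt; apply: (factor_vanishes (h := g) sizeQ _ _ _ h1);
    rewrite mulrC -Fgh; [exact: F0 | exact: szF | exact: FQ].
move/eqP: gradF; rewrite /F Fgh mderivM mevalD !mevalM g_pt h_pt mulr0 mul0r addr0.
by rewrite eq_sym oner_eq0.
Qed.

(** Over the field of order [s] each [gam] takes the value of [V]. A nonzero such value has power
    [s - 1] equal to 1, which kills the product in [gauss0], and the two terms in [gam i1]
    cancel. *)
Lemma gauss_at_tangency_point (L : closedFieldType) (iota : {rmorphism K -> L}) f P :
  tangency_data iota s V f P ->
  (forall i, i != ord0 -> mmap iota P (gauss i) = mmap iota P (V i)) /\
  mmap iota P (gauss ord0) = - \sum_(j < n.+2) P (lift ord0 j) * mmap iota P (V (lift ord0 j)).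
Proof.
move=> [P0 Ps _ _ [i i0 Vi]].
have [[r r_gt0 sE] [a mE] [b cE] _ _] := exponents.
have V_fix j : mmap iota P (V j) ^+ s = mmap iota P (V j).
  by rewrite sE; apply: mmap_frobenius => k; rewrite -sE.
have fix_m x : x ^+ s = x -> x ^+ m = x :> L by rewrite mE; apply: expr_pow.
have fix_c x : x ^+ s = x -> x ^+ c = x :> L by rewrite cE; apply: expr_pow.
have gamE j : mmap iota P (gam j) = mmap iota P (V j).
  by rewrite mmap_gam P0 !expr1n !mul1r fix_m // addrAC subrr add0r.
split=> [j j0|].
  rewrite mmap_gauss // P0 expr1n mul1r !gamE fix_c //.
  by case: eqP => // ->.
rewrite /gauss eqxx mmap_gauss0 P0 !expr1n !mul1r gamE fix_c // addrK.
have -> : \prod_(j < n.+2) (1 - mmap iota P (gam (lift ord0 j)) ^+ (s - 1)) = 0.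
  case: (unliftP ord0 i) i0 Vi => [k ->|->] // _ Vk.
  rewrite (bigD1 k) //= gamE; suff -> : mmap iota P (V (lift ord0 k)) ^+ (s - 1) = 1.
    by rewrite subrr mul0r.
  by apply: (mulfI Vk); rewrite mulr1 -exprS subn1 prednK // ltnW.
rewrite sub0r; congr (- _); apply: eq_bigr => j _; by rewrite gamE.
Qed.

End Hypersurface.

(** * Choice of the exponents and proof of the theorem *)

Lemma exists_admissible_exponents (K : finFieldType) n D r :
  (0 < r)%N -> exists m c N, admissible_exponents K n D (#|K| ^ r) m c N.
Proof.
move=> r_gt0; pose s := (#|K| ^ r)%N.
have s_gt1 : (1 < s)%N := card_exp_gt1 K r_gt0.
(* Since [t < s ^ t], this gives [m > D.+1] and [c > n.+2 * s], and the latter implies the bound on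
   [N = m * c]. *)
pose m := (s ^ D.+1)%N; pose c := (s ^ (n.+2 * s))%N.
have m_gt : (D.+1 < m)%N by apply: ltn_expl.
exists m, c, (m * c)%N; split; [by exists r | by exists D.+1 | by exists (n.+2 * s)%N | by [] |].
rewrite (ltnW m_gt) (leq_ltn_trans _ m_gt) //= mulnCA ltn_mul2l (leq_ltn_trans _ m_gt) //=.
by apply: leq_ltn_trans (ltn_expl _ s_gt1); rewrite leq_mul2l leq_subr orbT.
Qed.

Theorem theorem3p1 (K : finFieldType) (n d : nat) :
  (2 <= n)%N -> (1 <= d)%N ->
  exists (e : nat) (F : {mpoly K[n.+1]}),
    [/\ (0 < e)%N, is_homog e F, geom_irreducible F, hyp_smooth F &
        forall (k : nat) (f : {mpoly K[n.+1]}),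
          (1 <= k <= d)%N -> is_homog k f -> ~ inter_smooth f F].
Proof.
case: n => [|[|n]] // _ _.
have [L [iota L_alg]] := countable_algebraic_closure K.
(* The bound is [d.+1] because [msize] exceeds the degree by one. *)
have [fs0 fs0P] := finite_msize_le n.+3 K d.+1.
pose nonpower k (f : {mpoly K[n.+3]}) :=
  is_homog k f && has (fun m : 'X_{1..n.+3} => m ord0 != k) (msupp f).
pose fs := [seq f <- fs0 | has (nonpower^~ f) (seq.iota 0 d.+1)].
have [|r [D [V [r_gt0 V_homog tangent]]]] := exists_tangency_data L_alg (fs := fs).
  move=> f; rewrite mem_filter => /andP[/hasP[k _ /andP[hf /hasP[m mf mk]]] _].
  by exists k => //; exists m.
have [m [c [N exps]]] := exists_admissible_exponents K n D r_gt0.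
pose s := (#|K| ^ r)%N; pose F := hypersurface D s m c N V.
exists (N * s).+1, F; split=> //.
- exact: hypersurface_homog exps V_homog.
- exact: hypersurface_geom_irreducible exps V_homog.
- exact: hypersurface_smooth exps.
move=> k f /andP[k_gt0 kd] hf.
have [gen|nogen] := boolP (has (fun m : 'X_{1..n.+3} => m ord0 != k) (msupp f)); last first.
  (* Here [f] is 0 or a multiple of [x_0 ^ k], hence divisible by [x_0]. At the point at infinity
     its gradient, like that of [F], is supported on coordinate 0. *)
  have [i mi|g fg _] := mpolyX_factor (i := ord0) (f := f).
    by have /hasPn/(_ _ mi) := nogen; rewrite negbK => /eqP ->.
  have X0 : mmap iota (infinite_point (n := n) L) 'X_ord0 = 0 by rewrite mmapX mmap1U.
  apply: (tangent_not_inter_smooth (j := iota) (P := infinite_point (n := n) L)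
    (c := mmap iota (infinite_point (n := n) L) f^`M(ord0))).
  - by exists (lift ord0 ord0); rewrite /infinite_point eqxx oner_neq0.
  - by rewrite fg rmorphM /= X0 mul0r.
  - exact: hypersurface_infinite_point _ exps _ _.
  move=> i; rewrite (gradient_at_infinite_point _ exps).
  have [->|i0] := eqVneq i ord0; first by rewrite mulr1.
  rewrite mulr0 fg mderivM rmorphD !rmorphM /= X0 mul0r addr0 mderivX mnm1E.
  by rewrite eq_sym (negbTE i0) scale0r raddf0 mul0r.
have [|P tg] := tangent f.
  rewrite mem_filter fs0P ?andbT.
    by apply/hasP; exists k; rewrite ?mem_iota ?ltnS //; apply/andP.
  have [->|f0] := eqVneq f 0; first by rewrite msize0.
  by rewrite (msize_homog hf f0).
have [P0 Ps fP [a grad] _] := tg.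
have [gaussV gauss00] := gauss_at_tangency_point exps tg.
have V_fix i : mmap iota P (V i) ^+ s = mmap iota P (V i) by apply: mmap_frobenius.
have gradF i : i != ord0 -> mmap iota P F^`M(i) = mmap iota P (V i).
  by move=> i0; rewrite (hypersurface_mderiv _ exps) rmorphXn /= gaussV.
have gradF0 : mmap iota P F^`M(ord0) = mmap iota P (gauss D s m c N V ord0).
  by rewrite (hypersurface_mderiv _ exps) rmorphXn /= mmap_frobenius.
apply: (tangent_not_inter_smooth (j := iota) (P := P) (c := a)) => //.
- by exists ord0; rewrite P0 oner_neq0.
(* Frobenius fixes the values of [gauss] at [P], so [F] takes there the value of the sum of
   [x_i G_i], which [gauss00] makes 0. *)
- rewrite mmap_hypersurface big_ord_recl P0 mul1r mmap_frobenius // gauss00.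
  rewrite addrC; apply/eqP; rewrite subr_eq0; apply/eqP; apply: eq_bigr => i _.
  by rewrite mmap_frobenius // gaussV.
move=> i; have [->|i0] := eqVneq i ord0; last by rewrite gradF // grad.
(* As [f] vanishes at [P] and [P ord0 = 1], Euler's relation expresses the derivative in [x_0] by
   the others, in the same way as [gauss00] does for [F]. *)
have := congr1 (mmap iota P) (euler_homog hf); rewrite rmorphMn /= fP mul0rn.
rewrite rmorph_sum big_ord_recl /= rmorphM /= mmapX mmap1U P0 mul1r => /eqP.
rewrite addr_eq0 => /eqP ->; rewrite gradF0 gauss00 mulrN mulr_sumr; congr (- _).
by apply: eq_bigr => j _; rewrite rmorphM /= mmapX mmap1U grad // mulrCA.
Qed.
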